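(* Let $(X,d)$ be a compact metric space and let $\phi_m:X\to X$, $m=1,2,\ldots$, be a sequence of homeomorphisms. The non-autonomous system $(X,\phi_{1,\infty})$ is $\aleph_0$-expansive (in the two-sided sense for sequences of homeomorphisms) if and only if there is a finite open cover $\mathcal{B}$ of $X$ such that for every bisequence $\{B_m\}_{m=-\infty}^{\infty}$ of members of $\mathcal{B}$, the set $\bigcap_{m=-\infty}^{\infty}(\phi_1^m)^{-1}(\overline{B_m})$ has at most countably many elements.
   Context: For a sequence of homeomorphisms $\phi_{1,\infty}=\{\phi_m\}_{m=1}^\infty$ of $X$, write $\phi_1^m=\phi_m\circ\phi_{m-1}\circ\cdots\circ\phi_1$ for $m\ge 1$, $\phi_1^0=\mathrm{id}_X$, and $\phi_1^{-m}=(\phi_1^m)^{-1}$ for $m\ge 1$. A sequence of homeomorphisms $\phi_{1,\infty}$ of $(X,d)$ is $\aleph_0$-expansive if there is a constant $c>0$ such that for every $x\in X$ the set $\{y\in X: d(\phi_1^i(x),\phi_1^i(y))\le c \text{ for all } i\in\mathbb{Z}\}$ is at most countable. $\overline{B}$ denotes the closure of $B$; the sets $(\phi_1^m)^{-1}(\overline{B_m})$ are preimages under $\phi_1^m$. *)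

(* Defs.v *)
From HB Require Import structures.
From mathcomp Require Import all_boot all_order all_algebra.
From mathcomp Require Import all_classical all_reals all_analysis.

Set Implicit Arguments.
Unset Strict Implicit.
Unset Printing Implicit Defensive.

Import Order.TTheory GRing.Theory Num.Theory.
Local Open Scope classical_set_scope.
Local Open Scope ring_scope.

Definition homeomorphism (T U : topologicalType) (f : T -> U) : Prop :=
  exists g : U -> T, [/\ cancel f g, cancel g f, continuous f & continuous g].

(* The sequence is phi 1, phi 2, ...; the term phi 0 is never used. *)
Fixpoint iter_seq (T : Type) (phi : nat -> T -> T) (m : nat) : T -> T :=
  if m is n.+1 then phi n.+1 \o iter_seq phi n else id.

(* [Negz n] is the integer - n.+1.  For a bijective f, ['pinv_id setT f] is
   the inverse of f; [id] only supplies values outside the range of f, which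
   avoids assuming that T is inhabited. *)
Definition bi_iter (T : choiceType) (phi : nat -> T -> T) (m : int) : T -> T :=
  match m with
  | Posz n => iter_seq phi n
  | Negz n => 'pinv_id setT (iter_seq phi n.+1)
  end.

Definition aleph0_expansive (R : realType) (X : metricType R)
    (phi : nat -> X -> X) : Prop :=
  exists2 c : R, 0 < c &
    forall x : X, countable
      [set y | forall i : int, mdist (bi_iter phi i x) (bi_iter phi i y) <= c].

Definition finite_open_cover (T : topologicalType) (B : set (set T)) : Prop :=
  [/\ finite_set B, (forall U, B U -> open U) & \bigcup_(U in B) U = [set: T]].

(* Main.v *)
Require Import Defs.
From HB Require Import structures.
From mathcomp Require Import all_boot all_order all_algebra.
From mathcomp Require Import all_classical all_reals all_analysis.
From mathcomp Require Import finmap.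

Set Implicit Arguments.
Unset Strict Implicit.
Unset Printing Implicit Defensive.

Import Order.TTheory GRing.Theory Num.Theory.
Local Open Scope classical_set_scope.
Local Open Scope ring_scope.

(* If the closures of the members of a finite open cover have diameter at most
   the expansivity constant c, then any point x of an intersection indexed by a
   bisequence confines that intersection to the c-dynamical ball of x.
   Conversely, if c is small with respect to a Lebesgue number of the cover,
   the closed c-ball about each point of the orbit of x lies in a member of
   the cover, so these members form a bisequence whose intersection contains
   the c-dynamical ball of x. *)

(* [compact_cover] is only available for pointed spaces; the near-covering
   characterization, applied to the filter of large finite subsets of D, is
   not subject to this restriction. *)
Lemma compact_cover_compact (T : topologicalType) (A : set T) :
  compact A -> cover_compact A.
Proof.
move=> /compact_near_coveringP cptA I D f fopen Af.
pose fsub := [set E : {fset I} | {subset E <= D}].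
pose above (E : {fset I}) := [set E' | fsub E' /\ {subset E <= E'}].
pose F := filter_from fsub above.
have FF : Filter F.
  apply: filter_from_filter; first by exists fset0 => i.
  move=> E1 E2 E1D E2D; exists (E1 `|` E2)%fset.
    by move=> i /fsetUP[/E1D|/E2D].
  move=> E [ED E12]; split; split=> // i Ei; apply: E12; apply/fsetUP.
    by left.
  by right.
have [|E ED EA] := cptA _ F (fun E x => exists2 i, i \in E & f i x) FF.
  move=> x /Af[i Di fx]; exists (f i, above [fset i]%fset) => /=.
    split; first exact: open_nbhs_nbhs (conj (fopen i Di) fx).
    by exists [fset i]%fset => // j /fset1P ->; exact: mem_set.
  move=> [y E] [/= fiy [_ iE]]; exists i => //; exact/iE/fset11.
exists E => // x Ax.
by have [i iE fx] := EA E (conj ED (fun _ => id)) x Ax; exists i.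
Qed.

(** Balls of radius c/4 suffice: the closure of each lies in the concentric ball of radius c/2, so
    any two of its points are within c. *)
Lemma compact_small_cover (R : realType) (X : metricType R) (c : R) :
  compact [set: X] -> 0 < c ->
  exists2 B : set (set X), finite_open_cover B &
    forall U y z, B U -> closure U y -> closure U z -> mdist y z <= c.
Proof.
move=> cptX c0; have e0 : 0 < c / 2 / 2 by rewrite !divr_gt0.
pose f (x : X) := (ball x (c / 2 / 2))°.
have : finite_subset_cover [set: X] f [set: X].
  apply: compact_cover_compact => // [x _|x _].
    exact: open_interior.
  by exists x => //; exact: nbhsx_ballx.
move=> [D _ Dcover]; exists (f @` [set` D]).
  split; first exact/finite_image/finite_fset.
  - by move=> _ [x _ <-]; exact: open_interior.
  - by apply/seteqP; split => // x /Dcover [i Di fx]; exists (f i) => //; exists i.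
move=> _ y z [x _ <-] Uy Uz.
have near_center w : closure (f x) w -> ball x (c / 2) w.
  (* A point of the closure is within c/4 of some point of the ball, itself within c/4 of the
     centre. *)
  move=> /(_ _ (nbhsx_ballx w _ e0)) [v [/interior_subset xv wv]].
  by rewrite [c / 2]splitr; exact: ball_triangle xv (ball_sym wv).
have := ball_triangle (ball_sym (near_center _ Uy)) (near_center _ Uz).
by rewrite -splitr ballEmdist => /ltW.
Qed.

(** A radius that works at one point works, once halved, at all nearby points; compactness, applied
    along the filter [0^'+] of small radii, then gives one radius for the whole space. *)
Lemma lebesgue_number (R : realType) (X : metricType R) (B : set (set X)) :
  compact [set: X] -> (forall U, B U -> open U) ->
  \bigcup_(U in B) U = [set: X] ->
  exists2 c : R, 0 < c &
    forall x, exists2 U, B U & [set y | mdist x y <= c] `<=` U.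
Proof.
move=> /compact_near_coveringP cptX Bopen Bcover.
pose P (e : R) (x : X) := exists2 U, B U & [set y | mdist x y <= e] `<=` U.
have /filter_ex[e [e0 Pe]] : \forall e \near 0^'+, 0 < e /\ forall x, P e x.
  near=> e; split; first by near: e; exact: nbhs_right_gt.
  move=> x; have : [set: X] x by [].
  move: x; near: e; apply: (cptX _ _ P) => x _.
  have [U BU Ux] : (\bigcup_(U in B) U) x by rewrite Bcover.
  have /nbhs_ballP[r /= r0 rU] : nbhs x U.
    exact: open_nbhs_nbhs (conj (Bopen U BU) Ux).
  have r20 : 0 < r / 2 by rewrite divr_gt0.
  (* Half of r absorbs the move from x to x', the other half the radius e. The strict bound e < r/2
     lets the closed e-ball fit in the open r-ball. *)
  exists (ball x (r / 2), [set e | e < r / 2]).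
    by split; [exact: nbhsx_ballx | exact: nbhs_right_lt].
  move=> [x' e] [/= xx' er]; exists U => // y /= x'y; apply: rU.
  rewrite [r]splitr; apply: ball_triangle xx' _.
  by rewrite ballEmdist; exact: le_lt_trans er.
by exists e.
Unshelve. all: by end_near.
Qed.

Theorem theorem3p2 (R : realType) (X : metricType R)
    (cptX : compact [set: X]) (phi : nat -> X -> X)
    (phi_homeo : forall m : nat, (1 <= m)%N -> homeomorphism (phi m)) :
  aleph0_expansive phi <->
  exists2 B : set (set X), finite_open_cover B &
    forall Bs : int -> set X, (forall m : int, B (Bs m)) ->
      countable (\bigcap_(m in [set: int]) (bi_iter phi m @^-1` closure (Bs m))).
Proof.
split=> [[c c0 expc]|[B [_ Bopen Bcover] Bcount]].
  have [B Bfoc Bsmall] := compact_small_cover cptX c0.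
  exists B => // Bs BBs; set I := (X in countable X).
  (* The centre of the dynamical ball has to be a point of [I] itself, hence the separate empty
     case. *)
  have [->|/set0P[x Ix]] := eqVneq I set0; first exact: countable0.
  apply: sub_countable (expc x); apply: subset_card_le => y Iy i /=.
  by apply: (Bsmall (Bs i)) => //; [exact: Ix | exact: Iy].
have [c c0 leb] := lebesgue_number cptX Bopen Bcover.
exists c => // x.
(* The members are chosen separately for each i, since [Bcount] covers arbitrary bisequences. *)
have /choice[Bs BsP] i : exists U,
    B U /\ [set y | mdist (bi_iter phi i x) y <= c] `<=` U.
  by have [U] := leb (bi_iter phi i x); exists U.
apply: sub_countable (Bcount Bs (fun i => (BsP i).1)).
by apply: subset_card_le => y xy i _; apply/subset_closure/(BsP i).2/xy.
Qed.
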